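(* Let $L\ge1$ be fixed. For each $d$ let $f^{(d)}:\mathbb{R}^d\to\mathbb{C}$ be an $L$-hidden-layer network: $f^{(d)}(\mathbf{x})=\mathbf{A}^{(L+1)}\mathbf{x}^{(L)}(\mathbf{x})$, where $\mathbf{x}^{(0)}(\mathbf{x})=\mathbf{x}$ and $x_i^{(k)}(\mathbf{x})=\sigma_i^{(k)}\big((\mathbf{A}^{(k)}\mathbf{x}^{(k-1)}(\mathbf{x}))_i\big)$ for $k\in[L]$, $i\in[d_k]$, with $\mathbf{A}^{(k)}\in\mathbb{R}^{d_k\times d_{k-1}}$ for $k\in[L]$ ($d_0=d$), $\mathbf{A}^{(L+1)}\in\mathbb{C}^{1\times d_L}$ and functions $\sigma_i^{(k)}:\mathbb{R}\to\mathbb{R}$ (all of these may depend on $d$). Assume that the functions $\sigma_i^{(k)}$ are $O(1)$-Lipschitz, that the first hidden layer has width $d_1=p_d$, and that the weights are bounded in the sense that every row of every matrix $\mathbf{A}^{(k)}$, $k\in[L+1]$, has $\ell^1$ norm $O(1)$ (as $d\to\infty$). Then for every $\epsilon>0$ there exists a shallow Fourier network $f_N$ with $N$ units, where $$N\le\left(p_d\cdot O\left(1+\frac1{\epsilon^2}\right)\right)^{O(L)\left(1+\frac1\epsilon\right)^{L-1}},$$ such that $$\sup_{\mathbf{x}\in[-1,1]^d}|f^{(d)}(\mathbf{x})-f_N(\mathbf{x})|\le\epsilon .$$ The implied constants are independent of $d$ and $\epsilon$.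
   Context: A shallow Fourier network with $N$ units is a function of the form $\mathbf{x}\in\mathbb{R}^d\mapsto\sum_{k=1}^N u_k e^{i\mathbf{w}_k^T\mathbf{x}}$ with $u_k\in\mathbb{C}$, $\mathbf{w}_k\in\mathbb{R}^d$ (i.e. a one-hidden-layer network with complex exponential activation). *)

(* Defs.v *)
From HB Require Import structures.
From mathcomp Require Export all_boot all_order all_algebra.
From mathcomp Require Export all_classical all_reals all_analysis.
From mathcomp Require Export complex.

Set Implicit Arguments.
Unset Strict Implicit.
Unset Printing Implicit Defensive.
Import Order.TTheory GRing.Theory Num.Theory.
Import numFieldNormedType.Exports.
Local Open Scope classical_set_scope.
Local Open Scope ring_scope.
Local Open Scope complex_scope.

(* The modulus as an element of R; the norm `|z| of z : R[i] lives in R[i]. *)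
Notation normc := ComplexField.Normc.normc.

(* Layer 0 is the input, so that [width 0] is a dummy value. *)
Definition layer_dim (d : nat) (width : nat -> nat) (k : nat) : nat :=
  if k is 0 then d else width k.

(* An L-hidden-layer network on R^d, with hidden layers numbered 1, ..., L.
   [weight k] and [activation k] are those of layer k.+1.  They are given for
   all k, but the network function only depends on those with k < L. *)
Record network (R : realType) (L d : nat) := Network {
  width : nat -> nat;
  width_gt0 : forall k, (0 < width k)%N;
  weight : forall k, 'M[R]_(width k.+1, layer_dim d width k);
  activation : forall k, 'I_(width k.+1) -> R -> R;
  out_weight : 'rV[R[i]]_(layer_dim d width L) }.

Fixpoint layer (R : realType) (L d : nat) (net : network R L d) (x : 'cV[R]_d)
    (k : nat) : 'cV[R]_(layer_dim d (width net) k) :=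
  match k with
  | 0 => x
  | j.+1 =>
      \col_(i < width net j.+1)
        @activation R L d net j i ((weight net j *m layer net x j) i 0)
  end.

Definition network_fun (R : realType) (L d : nat) (net : network R L d)
    (x : 'cV[R]_d) : R[i] :=
  (out_weight net *m map_mx (real_complex R) (layer net x L)) 0 0.

(* exp(i t) for real t *)
Definition expi (R : realType) (t : R) : R[i] := cos t +i* sin t.

Definition shallow_fourier (R : realType) (d N : nat)
    (u : 'I_N -> R[i]) (w : 'I_N -> 'cV[R]_d) (x : 'cV[R]_d) : R[i] :=
  \sum_(k < N) u k * expi (((w k)^T *m x) 0 0).

Definition cube (R : realType) (d : nat) : set 'cV[R]_d :=
  [set x | forall i, -1 <= x i 0 <= 1].

(* The supremum is taken in \bar R, so that it is +oo if unbounded. *)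
Definition sup_dist (R : realType) (d : nat) (f g : 'cV[R]_d -> R[i]) : \bar R :=
  ereal_sup [set (normc (f x - g x))%:E | x in @cube R d].

(* Main.v *)
Require Import Defs.
From mathcomp Require Import ring lra.
Import Order.TTheory GRing.Theory Num.Theory.
Import numFieldNormedType.Exports.
Local Open Scope classical_set_scope.
Local Open Scope ring_scope.
Set Implicit Arguments.
Unset Strict Implicit.
Unset Printing Implicit Defensive.

(** Each activation is replaced by a polynomial of degree n, so that products of
    plane waves remain plane waves. By Jackson's theorem the degree n = O(1/eps)
    suffices for error O(eps). In the first layer the preactivation a.x is
    replaced by n sin(a.x / n), a single frequency up to sign, so the first layer
    uses p (n+1)^2 frequencies whatever d is. All units of a layer share their
    frequencies; each further layer takes n-fold sums of them, which raises
    their number to the power n, and the total is (p (n+1)^2)^(n^(L-1)).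
    Biases may be unbounded in d, hence each layer is recentred at its value
    for the input 0.

    Jackson's theorem is obtained from the Fejer-Korovkin kernel, sampled on a
    grid fine enough that sums over the grid compute Fourier coefficients
    exactly, so that no integral is needed. *)

(** * Jackson's theorem *)

Lemma norm_sin_le (R : realType) (t : R) : `|sin t| <= `|t|.
Proof.
wlog t0 : t / 0 <= t => [hw|].
  have [/hw //|/ltW t0] := leP 0 t.
  by have := hw (- t); rewrite oppr_ge0 sinN !normrN; apply.
have cs : {within `[0, t], continuous (@sin R)}.
  exact/continuous_subspaceT/continuous_sin.
have [c _] := MVT_segment t0 (fun x _ => is_derive_sin x) cs.
rewrite sin0 !subr0 => ->; rewrite normrM ler_piMl //; exact: cos_max.
Qed.

Lemma one_sub_cos (R : realType) (t : R) : 1 - cos t = 2 * sin (t / 2) ^+ 2.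
Proof.
have {1}-> : t = (t / 2) *+ 2 by rewrite -mulr_natr divfK.
by rewrite cos_mulr2n cos2sin2; ring.
Qed.

(** The mean value theorem gives t - sin t = (1 - cos c) t with c between 0 and t, and 1 - cos c = 2
    sin^2 (c/2) is at most |c|. The quadratic order is enough: it makes n sin(z/n) differ from z by
    at most z^2/n. *)
Lemma norm_sub_sin_le (R : realType) (t : R) : `|t - sin t| <= t ^+ 2.
Proof.
wlog t0 : t / 0 <= t => [hw|].
  have [/hw //|/ltW t0] := leP 0 t.
  have := hw (- t); rewrite oppr_ge0 sinN sqrrN -opprB opprK addrC normrN.
  by rewrite -normrN opprB addrC; apply.
have cs : {within `[0, t], continuous (@sin R)}.
  exact/continuous_subspaceT/continuous_sin.
have [c] := MVT_segment t0 (fun x _ => is_derive_sin x) cs.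
rewrite in_itv /= sin0 !subr0 => /andP[c0 ct] ->.
have -> : t - cos c * t = (1 - cos c) * t by ring.
rewrite normrM expr2 (ger0_norm t0) ler_wpM2r //.
rewrite one_sub_cos ger0_norm; last by rewrite mulr_ge0 // sqr_ge0.
have s2 : sin (c / 2) ^+ 2 <= `|sin (c / 2)|.
  by rewrite -[_ ^+ 2]ger0_norm ?sqr_ge0 // normrX expr2 ler_piMl // sin_max.
have := @norm_sin_le R (c / 2).
rewrite (@ger0_norm _ (c / 2)); [lra|lra].
Qed.

Lemma norm_cos_sub_le (R : realType) (s t : R) :
  `|cos s - cos t| <= 2 * `|sin ((t - s) / 2)|.
Proof.
set a := (t + s) / 2; set b := (t - s) / 2.
have -> : s = a - b by rewrite /a /b; field.
have -> : t = a + b by rewrite /a /b; field.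
rewrite cosB cosD.
have -> : cos a * cos b + sin a * sin b - (cos a * cos b - sin a * sin b)
   = 2 * (sin a * sin b) by ring.
by rewrite !normrM (ger0_norm (ler0n _ 2)) ler_wpM2l // ler_piMl // sin_max.
Qed.

(** * Exact trigonometric sums over an equispaced grid *)

Lemma cos_sub_natC (R : realType) (k l : nat) (t : R) :
  cos ((k%:R - l%:R) * t) = cos ((l%:R - k%:R) * t).
Proof. by rewrite -cosN -mulNr opprB. Qed.

(** Discrete orthogonality: a nonzero frequency below M in absolute value is not aliased to 0 by M
    equispaced points, so its sum vanishes for every shift t. *)
Lemma sum_cos_grid (R : realType) (M k l : nat) (t : R) :
  (k < M)%N -> (l < M)%N ->
  \sum_(j < M) cos ((k%:R - l%:R) * (t - 2 * pi * j%:R / M%:R))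
    = (M * (k == l))%:R.
Proof.
wlog kl : k l / (k <= l)%N => [hw kM lM|].
  have [/hw->//|/ltnW lk] := leqP k l.
  by under eq_bigr do rewrite cos_sub_natC; rewrite hw // eq_sym.
move=> kM lM; have M0 : M%:R != 0 :> R by rewrite pnatr_eq0; case: (M) kM.
have [<-|klne] := eqVneq k l.
  under eq_bigr do rewrite subrr mul0r cos0.
  by rewrite sumr_const card_ord muln1.
have {klne}kl : (k < l)%N by rewrite ltn_neqAle klne.
rewrite muln0.
set r := (l - k)%N; have rE : k%:R - l%:R = - r%:R :> R.
  by rewrite natrB ?(ltnW kl) // opprB.
have r0 : (0 < r)%N by rewrite subn_gt0.
have rM : (r < M)%N by rewrite (leq_ltn_trans _ lM) ?leq_subr.
set b : R := r%:R * pi / M%:R.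
have Mgt0 : 0 < M%:R :> R
  by rewrite ltr0n; apply: leq_ltn_trans rM.
have sb : 0 < sin b.
  apply: sin_gt0_pi; rewrite divr_gt0 ?mulr_gt0 ?Mgt0 ?ltr0n ?pi_gt0 //=.
  by rewrite ltr_pdivrMr // mulrC ltr_pM2l ?pi_gt0 // ltr_nat.
(* The identity 2 sin b cos x = sin(x + b) - sin(x - b), with x growing by 2b at each grid point,
   makes the sum telescope. Since 2bM = 2 pi r, the two end values agree. *)
pose S (j : nat) := sin (- r%:R * t - b + 2 * b * j%:R).
have tele (j : nat) : 2 * sin b * cos (- r%:R * (t - 2 * pi * j%:R / M%:R))
    = S j.+1 - S j.
  have -> : - r%:R * (t - 2 * pi * j%:R / M%:R) = - r%:R * t + 2 * b * j%:R.
    by rewrite /b; field.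
  rewrite /S -(natr1 j).
  have -> : - r%:R * t - b + 2 * b * (j%:R + 1) = - r%:R * t + 2 * b * j%:R + b
    by ring.
  have -> : - r%:R * t - b + 2 * b * j%:R = - r%:R * t + 2 * b * j%:R - b
    by ring.
  by rewrite sinD sinB; ring.
apply: (@mulfI _ (2 * sin b)); first by rewrite gt_eqF // mulr_gt0.
rewrite mulr0 mulr_sumr.
under eq_bigr do rewrite rE tele.
rewrite -(big_mkord xpredT (fun j => S j.+1 - S j)) telescope_sumr //.
rewrite /S mulr0 addr0.
have -> : - r%:R * t - b + 2 * b * M%:R = - r%:R * t - b + pi *+ 2 *+ r.
  by rewrite -[_ *+ r]mulr_natr -[pi *+ 2]mulr_natr /b; field.
have per n (x : R) : sin (x + pi *+ 2 *+ n) = sin x.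
  elim: n => [|n IH]; first by rewrite mulr0n addr0.
  by rewrite mulrS addrCA addrC sinD2pi.
by rewrite per subrr.
Qed.

(* This is |sum_k a_k exp(i k t)|^2. *)
Definition quad_cos (R : realType) (a : nat -> R) (N : nat) (t : R) : R :=
  \sum_(k < N) \sum_(l < N) a k * a l * cos ((k%:R - l%:R) * t).

Lemma quad_cos_ge0 (R : realType) (a : nat -> R) (N : nat) (t : R) :
  0 <= quad_cos a N t.
Proof.
have -> : quad_cos a N t =
    (\sum_(k < N) a k * cos (k%:R * t)) ^+ 2
    + (\sum_(k < N) a k * sin (k%:R * t)) ^+ 2.
  rewrite /quad_cos !expr2 !mulr_suml -big_split /=; apply: eq_bigr => k _.
  rewrite !mulr_sumr -big_split /=; apply: eq_bigr => l _.
  by rewrite mulrBl cosB; ring.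
by rewrite addr_ge0 // sqr_ge0.
Qed.

Lemma sum_quad_cos (R : realType) (a : nat -> R) (N M : nat) (t : R) :
  (N <= M)%N ->
  \sum_(j < M) quad_cos a N (t - 2 * pi * j%:R / M%:R)
    = M%:R * \sum_(k < N) a k ^+ 2.
Proof.
move=> NM; rewrite exchange_big mulr_sumr /=; apply: eq_bigr => k _.
rewrite exchange_big (bigD1 k) //= [X in _ + X]big1 => [|l lk].
  rewrite -mulr_sumr sum_cos_grid ?(leq_trans (ltn_ord _) NM) // eqxx muln1.
  by rewrite addr0; ring.
rewrite -mulr_sumr sum_cos_grid ?(leq_trans (ltn_ord _) NM) //.
have -> : (k == l :> nat) = false by rewrite eq_sym; apply: negbTE.
by rewrite muln0 mulr0.
Qed.

(** The cosine factor shifts the frequency k - l by one in both directions, so exactly the pairs of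
    neighbouring indices survive. Shifted indices reach N, whence N < M. With [a N = 0] the term k =
    N - 1 on the right, which has no partner in the double sum, vanishes. *)
Lemma sum_cos_quad_cos (R : realType) (a : nat -> R) (N M : nat) (t : R) :
  (N < M)%N -> a N = 0 ->
  \sum_(j < M) cos (t - 2 * pi * j%:R / M%:R)
               * quad_cos a N (t - 2 * pi * j%:R / M%:R)
    = M%:R * \sum_(k < N) a k * a k.+1.
Proof.
move=> NM aN; set tt := fun j : nat => t - 2 * pi * j%:R / M%:R.
have NM1 (i : 'I_N) : (i < M)%N by apply: (ltn_trans (ltn_ord i)).
have NM2 (i : 'I_N) : (i.+1 < M)%N by apply: leq_ltn_trans NM.
have pick (k : 'I_N) : \sum_(l < N) a l * (k.+1 == l)%:R = a k.+1.
  have [kN|] := ltnP k.+1 N.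
    rewrite (bigD1 (Ordinal kN)) //= eqxx mulr1 big1 ?addr0 // => l lk.
    have -> : (k.+1 == l) = false.
      by apply/negP => /eqP e; case/eqP: lk; apply/val_inj.
    by rewrite mulr0.
  move=> kN; have -> : k.+1 = N by apply/anti_leq; rewrite ltn_ord.
  by rewrite aN big1 // => l _; rewrite gtn_eqF // mulr0.
have prod (k l : 'I_N) :
    \sum_(j < M) cos (tt j) * (a k * a l * cos ((k%:R - l%:R) * tt j))
      = M%:R / 2 * (a k * (a l * (k.+1 == l)%:R) + a l * (a k * (l.+1 == k)%:R)).
  transitivity (\sum_(j < M) a k * a l / 2 *
      (cos ((k.+1%:R - l%:R) * tt j) + cos ((k%:R - l.+1%:R) * tt j))).
    apply: eq_bigr => j _; rewrite -(natr1 k) -(natr1 l).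
    move: (tt j) => s.
    have -> : (k%:R + 1 - l%:R) * s = (k%:R - l%:R) * s + s by ring.
    have -> : (k%:R - (l%:R + 1)) * s = (k%:R - l%:R) * s - s by ring.
    by rewrite cosD cosB; field.
  rewrite -mulr_sumr big_split /= !sum_cos_grid // !natrM (eq_sym (k : nat)).
  by field.
transitivity (\sum_(k < N) \sum_(l < N)
    M%:R / 2 * (a k * (a l * (k.+1 == l)%:R) + a l * (a k * (l.+1 == k)%:R))).
  under eq_bigr do rewrite mulr_sumr.
  rewrite exchange_big; apply: eq_bigr => k _ /=.
  under eq_bigr do rewrite mulr_sumr.
  by rewrite exchange_big; apply: eq_bigr => l _ /=; exact: prod.
under eq_bigr do rewrite -mulr_sumr big_split /=.
rewrite -mulr_sumr big_split /=.
have e1 : \sum_(i < N) \sum_(i0 < N) a i * (a i0 * (i.+1 == i0)%:R) =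
    \sum_(i < N) a i * a i.+1.
  by apply: eq_bigr => k _; rewrite -mulr_sumr pick.
by rewrite [X in _ + X]exchange_big /= e1; field.
Qed.

(** * Chebyshev polynomials of the first kind *)

Fixpoint chebyshev (R : comNzRingType) (n : nat) : {poly R} :=
  match n with
  | 0 => 1
  | n'.+1 => if n' is m.+1 then 2 *: ('X * chebyshev R n') - chebyshev R m else 'X
  end.

Lemma chebyshevSS (R : comNzRingType) (n : nat) :
  chebyshev R n.+2 = 2 *: ('X * chebyshev R n.+1) - chebyshev R n.
Proof. by []. Qed.

Lemma size_chebyshev (R : comNzRingType) (n : nat) :
  (size (chebyshev R n) <= n.+1)%N.
Proof.
elim/ltn_ind: n => -[|[|n]] IH; rewrite ?size_poly1 ?size_polyX //.
rewrite chebyshevSS (leq_trans (size_polyD _ _)) // geq_max size_polyN.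
apply/andP; split; last first.
  by apply: (leq_trans (IH n _)); rewrite ?ltnS // !leqW.
rewrite (leq_trans (size_scale_leq _ _)) // (leq_trans (size_polyMleq _ _)) //.
by rewrite size_polyX add2n ltnS IH.
Qed.

Lemma chebyshev_cos (R : realType) (n : nat) (t : R) :
  (chebyshev R n).[cos t] = cos (n%:R * t).
Proof.
elim/ltn_ind: n => -[|[|n]] IH.
- by rewrite hornerE mul0r cos0.
- by rewrite hornerX mul1r.
rewrite chebyshevSS hornerD hornerN hornerZ hornerM hornerX !IH // -(natr1 n.+1) -(natr1 n).
have -> : (n%:R + 1 + 1) * t = (n%:R + 1) * t + t by ring.
have -> : n%:R * t = (n%:R + 1) * t - t by ring.
by rewrite cosB cosD; ring.
Qed.

(** * Polynomial approximation of Lipschitz functions *)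

(** The values h(cos phi_j) are averaged with nonnegative weights of total mass 1 that concentrate
    near t. Their second moment is O(1/n^2), so the average differs from h(cos t) by O(H/n). Its
    even part in t is a polynomial in cos t. *)
Lemma jackson_cos (R : realType) (h : R -> R) (H : R) (n : nat) :
  (0 < n)%N -> (forall x y, `|h x - h y| <= H * `|x - y|) ->
  exists Q : {poly R}, (size Q <= n.+1)%N /\
    forall t, `|Q.[cos t] - h (cos t)| <= 5 * H / n%:R.
Proof.
move=> n0 hL.
have H0 : 0 <= H.
  by have := hL 1 0; rewrite subr0 normr1 mulr1; apply: le_trans.
(* With N coefficients the kernel has trigonometric degree N - 1 = n. M is the least grid size for
   which the sum with the cosine factor is exact. *)
pose N := n.+1; pose M := N.+1.
have Npos : 0 < N%:R :> R by rewrite ltr0n.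
have Mpos : 0 < M%:R :> R by rewrite ltr0n.
pose a (k : nat) : R := sin (k%:R * (pi / N%:R)).
pose A := \sum_(k < N) a k ^+ 2.
have aN : a N = 0 by rewrite /a mulrC divfK ?gt_eqF // sinpi.
have a0 : a 0 = 0 by rewrite /a mul0r sin0.
have A0 : 0 < A.
  have a1 : 0 < a 1.
    rewrite /a mul1r sin_gt0_pi // divr_gt0 ?pi_gt0 //=.
    by rewrite ltr_pdivrMr // ltr_pMr ?pi_gt0 // ltr1n.
  rewrite /A (bigD1 (Ordinal (n0 : (1 < N)%N))) //=.
  by rewrite ltr_wpDr ?exprn_gt0 // sumr_ge0 // => i _; rewrite sqr_ge0.
(* [a] is the Perron eigenvector of the adjacency matrix of a path. *)
have aA : \sum_(k < N) a k * a k.+1 = cos (pi / N%:R) * A.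
  have shift : \sum_(k < N) a k * a k.+1 = \sum_(k < N) a k * a k.-1.
    rewrite big_ord_recr [RHS]big_ord_recl /= aN a0 mulr0 mul0r addr0 add0r.
    by apply: eq_bigr => k _; rewrite /bump /= add1n mulrC.
  apply: (@mulfI _ 2); first by rewrite pnatr_eq0.
  rewrite [LHS]mulr_natl mulr2n {2}shift -big_split /= /A !mulr_sumr.
  apply: eq_bigr => -[[|k] /= _] _; first by rewrite a0; ring.
  rewrite /a -(natr1 k.+1) -(natr1 k); set s := pi / N%:R.
  have -> : (k%:R + 1 + 1) * s = (k%:R + 1) * s + s by ring.
  have -> : k%:R * s = (k%:R + 1) * s - s by ring.
  by rewrite sinB sinD; ring.
pose phi (j : nat) : R := 2 * pi * j%:R / M%:R.
pose om (t : R) (j : nat) := quad_cos a N (t - phi j) / (M%:R * A).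
have om_ge0 t j : 0 <= om t j.
  by rewrite divr_ge0 ?quad_cos_ge0 // mulr_ge0 // ltW.
have om1 t : \sum_(j < M) om t j = 1.
  by rewrite -mulr_suml sum_quad_cos // divff // mulf_neq0 // gt_eqF.
(* The second moment equals sin^2 (pi / (2N)), by the eigenvector identity [aA]; the 4 comes from pi
   <= 4. *)
have om_sin t : \sum_(j < M) om t j * sin ((t - phi j) / 2) ^+ 2 <= 4 / N%:R ^+ 2.
  have omc : \sum_(j < M) om t j * cos (t - phi j) = cos (pi / N%:R).
    transitivity ((M%:R * \sum_(k < N) a k * a k.+1) / (M%:R * A)).
      rewrite -(sum_cos_quad_cos t (ltnSn N) aN) mulr_suml.
      by apply: eq_bigr => j _; rewrite /om mulrAC [X in X / _]mulrC.
    by rewrite aA; field; rewrite !gt_eqF.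
  have -> : \sum_(j < M) om t j * sin ((t - phi j) / 2) ^+ 2
       = (1 - cos (pi / N%:R)) / 2.
    rewrite -omc -[X in X - _](om1 t) -sumrB mulr_suml; apply: eq_bigr => j _.
    have := one_sub_cos (t - phi j); move: (cos _) (sin _) => c s e.
    have -> : c = 1 - 2 * s ^+ 2 by rewrite -e; ring.
    by field.
  rewrite one_sub_cos mulrAC divff ?pnatr_eq0 // mul1r.
  have p4 : (pi : R) <= 4 by have := @pihalf_lt2 R; lra.
  have p0 := @pi_gt0 R.
  have s1 : `|sin ((pi : R) / N%:R / 2)| <= 2 / N%:R.
    apply: (le_trans (norm_sin_le _)); rewrite ger0_norm ?divr_ge0 ?(ltW p0) ?(ltW Npos) //.
    by rewrite mulrAC ler_pM2r ?invr_gt0 //; lra.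
  have -> : 4 / N%:R ^+ 2 = (2 / N%:R) ^+ 2 :> R by field; rewrite gt_eqF.
  by rewrite -[_ ^+ 2]ger0_norm ?sqr_ge0 // normrX lerXn2r // nnegrE // divr_ge0 // ltW.
(* The constant is 5 = 4 + 1: the second moment times N, plus the total mass times 1/N. *)
have err t : `|\sum_(j < M) h (cos (phi j)) * om t j - h (cos t)| <= 5 * H / N%:R.
  rewrite -[h (cos t)]mulr1 -(om1 t) mulr_sumr -sumrB.
  rewrite (le_trans (ler_norm_sum _ _ _)) //.
  have step (j : 'I_M) : `|h (cos (phi j)) * om t j - h (cos t) * om t j| <=
     H * (N%:R * (om t j * sin ((t - phi j) / 2) ^+ 2) + om t j / N%:R).
    rewrite -mulrBl normrM (ger0_norm (om_ge0 _ _)).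
    have -> : N%:R * (om t j * sin ((t - phi j) / 2) ^+ 2) + om t j / N%:R =
       (N%:R * sin ((t - phi j) / 2) ^+ 2 + N%:R^-1) * om t j by ring.
    rewrite mulrA ler_wpM2r // (le_trans (hL _ _)) // ler_wpM2l //.
    apply: (le_trans (norm_cos_sub_le _ _)).
    rewrite -real_normK ?num_real //; set s := `|_|.
    (* AM-GM: [2 s <= N s^2 + 1 / N] *)
    rewrite -subr_ge0.
    have -> : N%:R * s ^+ 2 + N%:R^-1 - 2 * s = (N%:R * s - 1) ^+ 2 / N%:R.
      by field; rewrite gt_eqF.
    by rewrite divr_ge0 ?sqr_ge0 // ltW.
  rewrite (le_trans (ler_sum _ (fun j _ => step j))) //.
  rewrite -mulr_sumr big_split /= -mulr_sumr -mulr_suml om1.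
  have -> : 5 * H / N%:R = H * (N%:R * (4 / N%:R ^+ 2) + 1 / N%:R).
    by field; rewrite gt_eqF.
  by rewrite ler_wpM2l // lerD2r ler_wpM2l // ltW.
(* The even part of cos((k - l)(t - phi_j)) in t is cos((k - l) phi_j) cos((k - l) t). The first
   factor goes into [c]; the second is the Chebyshev polynomial of degree |k - l|, written
   [maxn k l - minn k l], at cos t. *)
pose c j k l := h (cos (phi j)) * (a k * a l * cos ((k%:R - l%:R) * phi j)) / (M%:R * A).
exists (\sum_(j < M) \sum_(k < N) \sum_(l < N)
   c j k l *: chebyshev R (maxn k l - minn k l)).
split.
  rewrite -/N; elim/big_ind: _ => [|x y xN yN|j _]; first by rewrite size_poly0.
    by rewrite (leq_trans (size_polyD _ _)) // geq_max xN.
  elim/big_ind: _ => [|x y xN yN|k _]; first by rewrite size_poly0.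
    by rewrite (leq_trans (size_polyD _ _)) // geq_max xN.
  elim/big_ind: _ => [|x y xN yN|l _]; first by rewrite size_poly0.
    by rewrite (leq_trans (size_polyD _ _)) // geq_max xN.
  rewrite (leq_trans (size_scale_leq _ _)) // (leq_trans (size_chebyshev _ _)) //.
  by rewrite (leq_ltn_trans (leq_subr _ _)) // gtn_max !ltn_ord.
move=> t.
have dist (k l : nat) (s : R) :
    cos ((maxn k l - minn k l)%:R * s) = cos ((k%:R - l%:R) * s).
  case: (leqP k l) => kl; rewrite natrB ?(ltnW kl) //.
  exact: cos_sub_natC.
(* Symmetrizing the grid sum in [t] leaves a polynomial in [cos t]. *)
have -> : (\sum_(j < M) \sum_(k < N) \sum_(l < N)
      c j k l *: chebyshev R (maxn k l - minn k l)).[cos t] =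
    (\sum_(j < M) h (cos (phi j)) * om t j
     + \sum_(j < M) h (cos (phi j)) * om (- t) j) / 2.
  rewrite horner_sum -big_split mulr_suml; apply: eq_bigr => j _ /=.
  rewrite /om /quad_cos -mulrDr -mulrDl -big_split /= mulrA mulrAC.
  rewrite mulr_sumr !mulr_suml horner_sum; apply: eq_bigr => k _.
  rewrite -big_split /= horner_sum mulr_sumr !mulr_suml; apply: eq_bigr => l _.
  rewrite hornerZ chebyshev_cos dist /c mulrBr cosB.
  have -> : (k%:R - l%:R) * (- t - phi j) =
     - ((k%:R - l%:R) * t + (k%:R - l%:R) * phi j) by ring.
  rewrite cosN cosD; field.
  by rewrite !gt_eqF.
have nN : 5 * H / N%:R <= 5 * H / n%:R.
  by rewrite ler_wpM2l ?mulr_ge0 // lef_pV2 ?posrE ?ltr0n // ler_nat.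
have e1 := err t; have e2 := err (- t); rewrite cosN in e2.
apply: le_trans nN.
move: e1 e2; rewrite !ler_norml; set x := \sum_(j < M) _; set y := \sum_(j < M) _.
by move=> /andP[? ?] /andP[? ?]; apply/andP; split; lra.
Qed.

(** The substitution t = c + rho cos s carries the interval of radius rho about c to the previous
    case, with Lipschitz constant K rho. *)
Lemma jackson (R : realType) (f : R -> R) (K c rho : R) (n : nat) :
  (0 < n)%N -> 0 < rho -> (forall x y, `|f x - f y| <= K * `|x - y|) ->
  exists P : {poly R}, (size P <= n.+1)%N /\
    forall t, `|t - c| <= rho -> `|P.[t] - f t| <= 5 * K * rho / n%:R.
Proof.
move=> n0 r0 fL.
have hL x y : `|f (c + rho * x) - f (c + rho * y)| <= K * rho * `|x - y|.
  rewrite (le_trans (fL _ _)) //.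
  have -> : c + rho * x - (c + rho * y) = rho * (x - y) by ring.
  by rewrite normrM (gtr0_norm r0) mulrA.
have [Q [sQ hQ]] := jackson_cos n0 hL.
exists (Q \Po (rho^-1 *: ('X - c%:P))); split.
  rewrite (leq_trans (size_comp_poly_leq _ _)) //.
  rewrite size_scale ?invr_eq0 ?gt_eqF // size_XsubC /= muln1.
  by rewrite ltnS; case: (size Q) sQ.
move=> t tc; rewrite horner_comp hornerZ !hornerE.
set y := rho^-1 * _.
have ty : t = c + rho * y by rewrite /y mulrA divff ?gt_eqF // mul1r addrC subrK.
have y1 : -1 <= y <= 1.
  rewrite -ler_norml /y normrM gtr0_norm ?invr_gt0 //.
  by rewrite mulrC ler_pdivrMr // mul1r.
have := hQ (acos y); rewrite acosK ?in_itv //= -ty.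
by rewrite [5 * _]mulrA.
Qed.

(** * Spans of plane waves *)

Section FourierSpan.
Local Open Scope complex_scope.

(** The frequencies are explicit and the coefficients existential, so that many functions can share
    one family. Any finite index type is allowed: unit counts are then cardinalities of products and
    function spaces, and repeated frequencies do no harm. *)
Definition fourier_span (R : realType) (d : nat) (I : finType)
    (w : I -> 'cV[R]_d) (f : 'cV[R]_d -> R[i]) : Prop :=
  exists u : I -> R[i], forall x, f x = \sum_i u i * expi (((w i)^T *m x) 0 0).

Lemma expi0 (R : realType) : expi 0 = 1 :> R[i].
Proof. by rewrite /expi cos0 sin0. Qed.

Lemma expiD (R : realType) (s t : R) : expi (s + t) = expi s * expi t.
Proof. by rewrite /expi cosD sinD; simpc; rewrite (addrC (sin s * cos t)). Qed.

Lemma expi_sum (R : realType) (J : finType) (t : J -> R) :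
  expi (\sum_j t j) = \prod_j expi (t j).
Proof. exact: (big_morph _ (@expiD R) (expi0 R)). Qed.

Lemma expiMn (R : realType) (n : nat) (t : R) : expi (n%:R * t) = expi t ^+ n.
Proof.
elim: n => [|n IH]; first by rewrite mul0r expi0.
by rewrite -natr1 mulrDl mul1r expiD IH exprSr.
Qed.

Lemma sin_expi (R : realType) (t : R) :
  (sin t)%:C = (2 * 'i)^-1 * (expi t - expi (- t)).
Proof.
have i2 : 2 * 'i != 0 :> R[i] by rewrite mulf_neq0 ?pnatr_eq0 ?neq0Ci.
apply: (mulfI i2); rewrite mulVKf // /expi cosN sinN.
by rewrite -complexiE; simpc; rewrite -mulr2n; congr (_ +i* _); ring.
Qed.

Lemma fourier_span_sum (R : realType) (d : nat) (I J : finType)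
    (w : I -> 'cV[R]_d) (c : J -> R[i]) (F : J -> 'cV[R]_d -> R[i]) :
  (forall j, fourier_span w (F j)) ->
  fourier_span w (fun x => \sum_j c j * F j x).
Proof.
move=> /choice[u Fu]; exists (fun i => \sum_j c j * u j i) => x.
under eq_bigr do rewrite Fu mulr_sumr.
rewrite exchange_big; apply: eq_bigr => i _ /=.
by rewrite mulr_suml; apply: eq_bigr => j _; rewrite mulrA.
Qed.

Lemma fourier_span_expi (R : realType) (d : nat) (I : finType)
    (w : I -> 'cV[R]_d) (i : I) :
  fourier_span w (fun x => expi (((w i)^T *m x) 0 0)).
Proof.
exists (fun j => (j == i)%:R) => x.
rewrite (bigD1 i) //= eqxx mul1r big1 ?addr0 // => j /negbTE ->.
by rewrite mul0r.
Qed.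

Lemma fourier_span_const (R : realType) (d : nat) (I : finType)
    (w : I -> 'cV[R]_d) (c : R[i]) (i : I) :
  w i = 0 -> fourier_span w (fun=> c).
Proof.
move=> wi; have [u hu] := fourier_span_expi w i.
exists (fun j => c * u j) => x; have := hu x.
rewrite wi trmx0 mul0mx mxE expi0 => e1.
by under eq_bigr do rewrite -mulrA; rewrite -mulr_sumr -e1 mulr1.
Qed.

Lemma fourier_span_reindex (R : realType) (d : nat) (I J : finType)
    (phi : J -> I) (w : I -> 'cV[R]_d) (f : 'cV[R]_d -> R[i]) :
  fourier_span (w \o phi) f -> fourier_span w f.
Proof.
move=> [u fu].
have [v hv] := fourier_span_sum u (fun j => fourier_span_expi w (phi j)).
by exists v => x; rewrite fu hv.
Qed.

(** Expanding the product gives one term for each choice h of a wave in every factor, and the chosen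
    frequencies add up. *)
Lemma fourier_span_prod (R : realType) (d n : nat) (I : finType)
    (w : I -> 'cV[R]_d) (F : 'I_n -> 'cV[R]_d -> R[i]) :
  (forall j, fourier_span w (F j)) ->
  fourier_span (fun h : {ffun 'I_n -> I} => \sum_j w (h j))
    (fun x => \prod_j F j x).
Proof.
move=> /choice[u Fu]; exists (fun h : {ffun 'I_n -> I} => \prod_j u j (h j)) => x.
under eq_bigr do rewrite Fu.
rewrite bigA_distr_bigA; apply: eq_bigr => h _ /=.
rewrite big_split; congr (_ * _).
by rewrite -expi_sum linear_sum mulmx_suml summxE.
Qed.

(** Each power of g up to n is padded with constant factors 1 to a product of exactly n factors; the
    zero frequency at [i0] provides these constants. Hence all monomials share the same
    frequencies. *)
Lemma fourier_span_horner (R : realType) (d n : nat) (I : finType)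
    (w : I -> 'cV[R]_d) (i0 : I) (g : 'cV[R]_d -> R) (P : {poly R}) :
  w i0 = 0 -> (size P <= n.+1)%N -> fourier_span w (fun x => (g x)%:C) ->
  fourier_span (fun h : {ffun 'I_n -> I} => \sum_j w (h j))
    (fun x => (P.[g x])%:C).
Proof.
move=> w0 sP gw.
have pw (k : 'I_n.+1) :
    fourier_span (fun h : {ffun 'I_n -> I} => \sum_j w (h j))
      (fun x => (g x)%:C ^+ k).
  have := @fourier_span_prod R d n I w
    (fun j => if (j < k)%N then (fun x => (g x)%:C) else (fun=> 1)) _.
  case=> [j|u hu]; first by case: ifP => // _; exact: fourier_span_const w0.
  exists u => x; rewrite -hu.
  under eq_bigr => j _ do rewrite (fun_if (fun f => f x)).
  rewrite -big_mkcond /= (big_ord_narrow (ltn_ord k : (k <= n)%N)).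
  by rewrite prodr_const card_ord.
have [u hu] := fourier_span_sum (fun k : 'I_n.+1 => (P`_k)%:C) pw.
exists u => x; rewrite -hu (horner_coef_wide _ sP) rmorph_sum /=.
by apply: eq_bigr => k _; rewrite rmorphM rmorphXn.
Qed.

(* The index q stands for exp(i q.1 s) exp(- i q.2 s), where s = a.x / B. *)
Lemma fourier_span_ridge (R : realType) (d n : nat) (a : 'rV[R]_d) (B c : R)
    (P : {poly R}) :
  (size P <= n.+1)%N ->
  fourier_span
    (fun q : 'I_n.+1 * 'I_n.+1 => ((q.1%:R - q.2%:R) / B) *: a^T)
    (fun x => (P.[c * sin ((a *m x) 0 0 / B)])%:C).
Proof.
move=> sP; set w := fun q => _.
have pw (k : 'I_n.+1) :
    fourier_span w (fun x => (sin ((a *m x) 0 0 / B))%:C ^+ k).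
  (* Term j of the binomial expansion of (exp(is) - exp(-is))^k has k - j positive and j negative
     exponentials. *)
  pose q (j : 'I_k.+1) : 'I_n.+1 * 'I_n.+1 := (inord (k - j), inord j).
  have [u hu] := fourier_span_sum
    (fun j : 'I_k.+1 => (2 * 'i)^-1 ^+ k * ((-1) ^+ j * 'C(k, j)%:R))
    (fun j => fourier_span_expi w (q j)).
  exists u => x; rewrite -hu sin_expi exprMn exprBn mulr_sumr.
  apply: eq_bigr => j _; rewrite -mulrA -[_ *+ 'C(k, j)]mulr_natr.
  rewrite -!expiMn -!mulrA [expi _ * _]mulrC mulrA; congr (_ * _).
  congr (_ * _); rewrite [RHS]mulrC mulrAC -expiD; congr (expi _ * _).
  have jk : (j <= k)%N by rewrite -ltnS.
  have jn : (j < n.+1)%N by rewrite (leq_ltn_trans jk).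
  have kjn : (k - j < n.+1)%N by rewrite (leq_ltn_trans (leq_subr _ _)).
  have trZ (s : R) : ((s *: a^T)^T *m x) 0 0 = s * (a *m x) 0 0.
    by rewrite !mxE mulr_sumr; apply: eq_bigr => i _; rewrite !mxE mulrA.
  by rewrite /w trZ /= !inordK // natrB //; ring.
have [u hu] := fourier_span_sum (fun k : 'I_n.+1 => (P`_k * c ^+ k)%:C) pw.
exists u => x; rewrite -hu (horner_coef_wide _ sP) rmorph_sum /=.
by apply: eq_bigr => k _; rewrite exprMn mulrA rmorphM rmorphXn.
Qed.

End FourierSpan.

(** * Networks *)

Lemma norm_lin_comb_le (R : realType) (n : nat) (a y : 'I_n -> R) (W e : R) :
  0 <= e -> \sum_j `|a j| <= W -> (forall j, `|y j| <= e) ->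
  `|\sum_j a j * y j| <= W * e.
Proof.
move=> e0 aW ye; rewrite (le_trans (ler_norm_sum _ _ _)) //.
rewrite (le_trans _ (ler_wpM2r e0 aW)) // mulr_suml ler_sum // => j _.
by rewrite normrM ler_wpM2l.
Qed.

(** Only the first m hidden layers are constrained, which suits induction on the depth. *)
Definition admissible (R : realType) (L d : nat) (net : network R L d)
    (K W : R) (m : nat) : Prop :=
  forall k, (k < m)%N -> forall i : 'I_(width net k.+1),
    (forall s t, `|@activation R L d net k i s - @activation R L d net k i t|
       <= K * `|s - t|)
    /\ \sum_j `|weight net k i j| <= W.

Lemma admissibleW (R : realType) (L d : nat) (net : network R L d)
    (K W : R) (m : nat) :
  admissible net K W m.+1 -> admissible net K W m.
Proof. by move=> h k km; apply: h; exact: ltnW. Qed.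

Lemma layerS (R : realType) (L d : nat) (net : network R L d) (x : 'cV[R]_d)
    (k : nat) (i : 'I_(width net k.+1)) :
  layer net x k.+1 i 0 =
    activation i (\sum_j weight net k i j * layer net x k j 0).
Proof. by rewrite /= mxE mxE. Qed.

(** Each layer multiplies deviations in the sup norm by at most K W, and differences cancel the
    values of the activations at 0. The bound is thus free of d and of the biases. *)
Lemma layer_dev (R : realType) (L d : nat) (net : network R L d) (K W : R)
    (m : nat) (x : 'cV[R]_d) :
  0 <= K -> 0 <= W -> admissible net K W m -> cube x ->
  forall i, `|layer net x m i 0 - layer net 0 m i 0| <= (K * W) ^+ m.
Proof.
move=> K0 W0; elim: m => [|m IH] adm xc i.
  by rewrite /= mxE subr0 ler_norml; exact: xc.
have [lip row] := adm m (ltnSn m) i.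
rewrite !layerS (le_trans (lip _ _)) // exprS -mulrA ler_wpM2l //.
rewrite -sumrB; under eq_bigr do rewrite -mulrBr.
apply: norm_lin_comb_le => //; first by rewrite exprn_ge0 // mulr_ge0.
exact: IH (admissibleW adm) xc.
Qed.

(** [E] is fixed before the network and n. Its two terms are the Jackson error on radius W + 1,
    where the 1 keeps the radius positive, and K times the error W^2/n of replacing z by n
    sin(z/n). *)
Lemma first_layer_approx (R : realType) (K W : R) : 0 <= K -> 0 <= W ->
  exists E : R, 0 <= E /\
  forall (L d : nat) (net : network R L d) (n : nat),
  admissible net K W 1 -> (0 < n)%N ->
  exists (I : finType) (w : I -> 'cV[R]_d) (i0 : I)
         (g : 'I_(width net 1) -> 'cV[R]_d -> R),
    [/\ #|I| = (width net 1 * n.+1 ^ 2)%N, w i0 = 0,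
        forall i, fourier_span w (fun x => (g i x)%:C%C) &
        forall x i, cube x -> `|g i x - layer net x 1 i 0| <= E / n%:R].
Proof.
move=> K0 W0; exists (5 * K * (W + 1) + K * W ^+ 2); split.
  by rewrite addr_ge0 ?mulr_ge0 ?sqr_ge0 // addr_ge0.
move=> L d net n adm n0.
have n0' : 0 < n%:R :> R by rewrite ltr0n.
have /choice[P hP] : forall i : 'I_(width net 1), exists P : {poly R},
    (size P <= n.+1)%N /\
    forall t, `|t - 0| <= W + 1 ->
      `|P.[t] - activation i t| <= 5 * K * (W + 1) / n%:R.
  move=> i; apply: jackson => //; first by rewrite ltr_wpDl.
  by case: (adm 0 isT i).
pose ws (i : 'I_(width net 1)) (q : 'I_n.+1 * 'I_n.+1) :=
  ((q.1%:R - q.2%:R) / n%:R) *: (row i (weight net 0))^T.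
exists ('I_(width net 1) * ('I_n.+1 * 'I_n.+1))%type, (fun q => ws q.1 q.2).
exists (Ordinal (width_gt0 net 1), (ord0, ord0)).
exists (fun i x =>
  (P i).[n%:R * sin ((row i (weight net 0) *m x) 0 0 / n%:R)]).
split.
- by rewrite !card_prod !card_ord mulnn.
- by rewrite /ws subrr mul0r scale0r.
- move=> i; apply: (fourier_span_reindex (phi := fun q => (i, q))).
  exact: fourier_span_ridge (hP i).1.
move=> x i xc; have [lip row_le] := adm 0 isT i.
rewrite layerS; set z := \sum_j _.
have -> : (row i (weight net 0) *m x) 0 0 = z.
  by rewrite mxE; apply: eq_bigr => j _; rewrite mxE.
have zW : `|z| <= W.
  rewrite -[W]mulr1; apply: norm_lin_comb_le => // j.
  by rewrite ler_norml; exact: xc.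
set s := n%:R * _.
have sz : `|s - z| <= W ^+ 2 / n%:R.
  have {1}-> : z = n%:R * (z / n%:R) by rewrite mulrC divfK ?gt_eqF.
  rewrite -mulrBr normrM (gtr0_norm n0') distrC.
  have := norm_sub_sin_le (z / n%:R).
  rewrite -(ler_pM2l n0') => /le_trans -> //.
  have -> : n%:R * (z / n%:R) ^+ 2 = z ^+ 2 / n%:R by field; rewrite gt_eqF.
  by rewrite ler_wpM2r ?invr_ge0 ?ler0n // -real_normK ?num_real // lerXn2r ?nnegrE.
have sW : `|s - 0| <= W + 1.
  rewrite subr0 normrM (gtr0_norm n0').
  have := norm_sin_le (z / n%:R); rewrite -(ler_pM2l n0') => /le_trans -> //.
  rewrite normrM normfV (gtr0_norm n0') mulrC divfK ?gt_eqF //.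
  by rewrite (le_trans zW) // lerDl.
rewrite (le_trans (ler_distD (activation i s) _ _)) // mulrDl lerD //.
  exact: (hP i).2.
by rewrite (le_trans (lip _ _)) // -mulrA ler_wpM2l.
Qed.

(** Induction on depth: a new layer adds its Jackson error to K W times the previous error, and its
    degree-n polynomials replace the index type I by functions from n points to I. *)
Lemma layer_approx (R : realType) (K W : R) (k : nat) : 0 <= K -> 0 <= W ->
  exists E : R, 0 <= E /\
  forall (L d : nat) (net : network R L d) (n : nat),
  admissible net K W k.+1 -> (0 < n)%N ->
  exists (I : finType) (w : I -> 'cV[R]_d) (i0 : I)
         (g : 'I_(width net k.+1) -> 'cV[R]_d -> R),
    [/\ #|I| = ((width net 1 * n.+1 ^ 2) ^ (n ^ k))%N, w i0 = 0,
        forall i, fourier_span w (fun x => (g i x)%:C%C) &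
        forall x i, cube x -> `|g i x - layer net x k.+1 i 0| <= E / n%:R].
Proof.
move=> K0 W0; elim: k => [|k [E [E0 IH]]]; first exact: first_layer_approx.
(* This bounds how far the approximate preactivation strays from its exact value at input 0: the
   true deviation plus the inherited error, where E/n <= E; the 1 ensures positivity. *)
pose rho := W * ((K * W) ^+ k.+1 + E) + 1.
have rho0 : 0 < rho.
  by rewrite ltr_wpDl // mulr_ge0 // addr_ge0 // exprn_ge0 // mulr_ge0.
exists (5 * K * rho + K * (W * E)); split.
  by rewrite addr_ge0 // !mulr_ge0 // ltW.
move=> L d net n adm n0.
have n0' : 0 < n%:R :> R by rewrite ltr0n.
have En : E / n%:R <= E by rewrite ler_pdivrMr // ler_peMr // ler1n.
have En0 : 0 <= E / n%:R by rewrite divr_ge0 // ltW.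
have [I [w [i0 [g [cI w0 gw gE]]]]] := IH L d net n (admissibleW adm) n0.
pose c (i : 'I_(width net k.+2)) :=
  \sum_j weight net k.+1 i j * layer net 0 k.+1 j 0.
have /choice[P hP] : forall i : 'I_(width net k.+2), exists P : {poly R},
    (size P <= n.+1)%N /\
    forall t, `|t - c i| <= rho ->
      `|P.[t] - activation i t| <= 5 * K * rho / n%:R.
  move=> i; apply: jackson => //.
  by case: (adm k.+1 (ltnSn _) i).
exists {ffun 'I_n -> I}, (fun h : {ffun 'I_n -> I} => \sum_j w (h j)).
exists [ffun=> i0].
exists (fun i x => (P i).[\sum_j weight net k.+1 i j * g j x]).
split.
- by rewrite card_ffun card_ord cI -expnM -expnSr.
- by rewrite big1 // => j _; rewrite ffunE.
- move=> i; apply: (fourier_span_horner w0 (hP i).1).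
  (* The linear map creates no new frequencies, because all units below share theirs. *)
  have [u hu] := fourier_span_sum (fun j => (weight net k.+1 i j)%:C%C) gw.
  exists u => x; rewrite -hu rmorph_sum /=.
  by apply: eq_bigr => j _; rewrite rmorphM.
move=> x i xc; have [lip row_le] := adm k.+1 (ltnSn _) i.
rewrite layerS; set s := \sum_j _ * g j x; set z := \sum_j _ * _.
have sz : `|s - z| <= W * (E / n%:R).
  rewrite /s /z -sumrB; under eq_bigr do rewrite -mulrBr.
  by apply: norm_lin_comb_le => // j; exact: gE.
have zc : `|z - c i| <= W * (K * W) ^+ k.+1.
  rewrite /z /c -sumrB; under eq_bigr do rewrite -mulrBr.
  apply: norm_lin_comb_le => //; first by rewrite exprn_ge0 // mulr_ge0.
  by move=> j; exact: layer_dev (admissibleW adm) xc j.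
have sc : `|s - c i| <= rho.
  rewrite (le_trans (ler_distD z _ _)) // addrC (le_trans (lerD zc sz)) //.
  by rewrite -mulrDr ler_wpDr // ler_wpM2l // lerD2l.
rewrite (le_trans (ler_distD (activation i s) _ _)) // mulrDl lerD //.
  exact: (hP i).2.
by rewrite (le_trans (lip _ _)) // -!mulrA ler_wpM2l.
Qed.

(** * The output layer and the number of units *)

Lemma normc_sum (R : realType) (J : finType) (F : J -> R[i]) :
  normc (\sum_j F j) <= \sum_j normc (F j).
Proof.
elim/big_ind2: _ => [|x a y b xa yb|//]; first by rewrite Normc.normc0.
by rewrite (le_trans (le_normcD _ _)) // lerD.
Qed.

Lemma normc_real (R : realType) (r : R) : normc (r%:C)%C = `|r|.
Proof. by rewrite /normc /= expr0n addr0 sqrtr_sqr. Qed.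

Lemma shallow_fourier_span (R : realType) (d : nat) (I : finType)
    (w : I -> 'cV[R]_d) (f : 'cV[R]_d -> R[i]) :
  fourier_span w f ->
  exists (u : 'I_#|I| -> R[i]) (v : 'I_#|I| -> 'cV[R]_d),
    forall x, f x = shallow_fourier u v x.
Proof.
move=> [u fu]; exists (u \o enum_val), (w \o enum_val) => x.
by rewrite fu (reindex (@enum_val I I)) //; exact/onW_bij/enum_val_bij.
Qed.

(** The output layer is linear: it keeps the frequencies and multiplies the error by at most W. *)
Lemma network_approx (R : realType) (K W : R) (k : nat) : 0 <= K -> 0 <= W ->
  exists E : R, 0 <= E /\
  forall (d : nat) (net : network R k.+1 d) (n : nat),
  admissible net K W k.+1 -> \sum_j normc (out_weight net 0 j) <= W ->
  (0 < n)%N ->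
  exists (N : nat) (u : 'I_N -> R[i]) (w : 'I_N -> 'cV[R]_d),
    N = ((width net 1 * n.+1 ^ 2) ^ (n ^ k))%N /\
    forall x, cube x ->
      normc (network_fun net x - shallow_fourier u w x) <= E / n%:R.
Proof.
move=> K0 W0; have [E [E0 approx]] := layer_approx k K0 W0.
exists (W * E); split=> [|d net n adm out n0]; first exact: mulr_ge0.
have [I [w [_ [g [cI _ gw gE]]]]] := approx _ d net n adm n0.
have /shallow_fourier_span[u [v uv]] :=
  fourier_span_sum (fun j => out_weight net 0 j) gw.
exists #|I|, u, v; split=> // x xc.
rewrite -uv /network_fun mxE -sumrB (le_trans (normc_sum _)) //.
rewrite -mulrA; apply: le_trans (ler_wpM2r _ out); last by rewrite divr_ge0.
rewrite mulr_suml ler_sum // => j _; rewrite mxE -mulrBr Normc.normcM.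
rewrite -rmorphB normc_real ler_wpM2l //; last first.
  by rewrite distrC; exact: gE.
by case: (out_weight net 0 j) => a b; exact: sqrtr_ge0.
Qed.

Lemma nat_near (R : realType) (a : R) : 0 <= a ->
  exists n : nat, [/\ (0 < n)%N, a <= n%:R & n%:R <= a + 1].
Proof.
move=> a0; exists (Num.truncn a).+1; have /andP[l r] := truncn_itv a0.
by split=> //; [exact: ltW | rewrite -natr1 lerD2r].
Qed.

(** Base and exponent are bounded separately; the new base is at least 1, so enlarging the exponent
    is monotone. *)
Lemma unit_count_le (R : realType) (p n k : nat) (D eps : R) :
  (0 < p)%N -> (0 < n)%N -> 0 < eps -> 1 <= D -> n%:R <= D * (1 + 1 / eps) ->
  ((p * n.+1 ^ 2) ^ (n ^ k))%:R <=
    (p%:R * (8 * D ^+ 2 * (1 + 1 / eps ^+ 2)))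
      `^ (D ^+ k * k.+1%:R * (1 + 1 / eps) ^+ k).
Proof.
move=> p0 n0 e0 D1 nD.
have -> : 1 / eps ^+ 2 = (1 / eps) ^+ 2 by rewrite expr_div_n expr1n.
set b := p%:R * _.
have D0 : 0 <= D by apply: le_trans D1.
set X := 1 / eps in b nD *.
have X0 : 0 <= X by rewrite divr_ge0 // ltW.
have n1 : 1 <= n%:R :> R by rewrite ler1n.
have base : (p * n.+1 ^ 2)%:R <= b.
  rewrite natrM natrX ler_wpM2l //.
  have h : n.+1%:R <= 2 * (D * (1 + X)) by rewrite -natr1; lra.
  have {}h : n.+1%:R ^+ 2 <= (2 * (D * (1 + X))) ^+ 2.
    by rewrite lerXn2r ?nnegrE ?(le_trans _ h).
  rewrite (le_trans h) // -subr_ge0.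
  (* This is (1 + X)^2 <= 2 (1 + X^2), scaled by 4 D^2. *)
  have -> : 8 * D ^+ 2 * (1 + X ^+ 2) - (2 * (D * (1 + X))) ^+ 2 =
    (2 * D * (1 - X)) ^+ 2 by ring.
  exact: sqr_ge0.
have b1 : 1 <= b by rewrite (le_trans _ base) // ler1n muln_gt0 p0.
have b0 : 0 <= b by apply: le_trans b1.
have D1X : 0 <= D * (1 + X) by rewrite mulr_ge0 // addr_ge0.
apply: (@le_trans _ _ (b ^+ (n ^ k))).
  by rewrite natrX lerXn2r // nnegrE.
rewrite -(powR_mulrn _ b0) ler_powR // natrX.
apply: (@le_trans _ _ ((D * (1 + X)) ^+ k)); first by rewrite lerXn2r // nnegrE.
rewrite exprMn ler_wpM2r ?exprn_ge0 ?addr_ge0 //.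
by rewrite ler_peMr ?exprn_ge0 // ler1n.
Qed.

Theorem theorem12 (R : realType) (L : nat) (hL : (1 <= L)%N)
    (net : forall d : nat, network R L d)
    (p : nat -> nat) (hp : forall d, width (net d) 1 = p d)
    (d0 : nat) (K W : R)
    (hlip : forall d, (d0 <= d)%N ->
       forall k, (k < L)%N -> forall i : 'I_(width (net d) k.+1),
       K.-lipschitz (@activation R L d (net d) k i : R -> R))
    (hweight : forall d, (d0 <= d)%N ->
       forall k, (k < L)%N -> forall i : 'I_(width (net d) k.+1),
       \sum_j `|weight (net d) k i j| <= W)
    (hout : forall d, (d0 <= d)%N ->
       \sum_j normc (out_weight (net d) 0 j) <= W) :
  exists C1 C2 : R, 0 < C1 /\ 0 < C2 /\
    forall d, (d0 <= d)%N -> forall eps : R, 0 < eps ->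
      exists (N : nat) (u : 'I_N -> R[i]) (w : 'I_N -> 'cV[R]_d),
        (N%:R <= ((p d)%:R * (C1 * (1 + 1 / eps ^+ 2)))
                   `^ (C2 * L%:R * (1 + 1 / eps) ^+ (L - 1)))
        /\ (sup_dist (network_fun (net d)) (shallow_fourier u w) <= eps%:E)%E.
Proof.
case: L hL net hp hlip hweight hout => [//|k] _ net hp hlip hweight hout.
rewrite subn1 /=.
(* Absolute values supply the nonnegativity required of both bounds. *)
have adm d : (d0 <= d)%N -> admissible (net d) `|K| `|W| k.+1.
  move=> dd j jk i; split=> [s t|].
    have /= h := hlip d dd j jk i (s, t) (conj I I).
    by rewrite (le_trans h) // ler_wpM2r // ler_norm.
  by rewrite (le_trans (hweight d dd j jk i)) // ler_norm.
have [E [E0 approx]] := network_approx k (normr_ge0 K) (normr_ge0 W).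
(* These are the constants of the unit count for D = E + 1, where E depends on K, W and L alone. *)
exists (8 * (E + 1) ^+ 2), ((E + 1) ^+ k).
have E1 : 0 < E + 1 by rewrite ltr_wpDl.
split; first by rewrite mulr_gt0 // exprn_gt0.
split=> [|d dd eps e0]; first by rewrite exprn_gt0.
(* The degree n >= E/eps makes the error E/n at most eps, while n <= E/eps + 1 <= (E + 1)(1 +
   1/eps). *)
have [n [n0 En nE]] := nat_near (divr_ge0 E0 (ltW e0)).
have outW := le_trans (hout d dd) (ler_norm W).
have [N [u [w [NE uw]]]] := approx d (net d) n (adm d dd) outW n0.
exists N, u, w; split.
  rewrite NE hp; apply: unit_count_le => //.
  - by rewrite -hp width_gt0.
  - by rewrite lerDr.
  - rewrite (le_trans nE) // mulrDr mulr1 mulrDl mul1r.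
    have ie : 0 <= 1 / eps by rewrite divr_ge0 // ltW.
    by rewrite div1r in ie *; lra.
apply: ge_ereal_sup => _ [x xc <-]; rewrite lee_fin (le_trans (uw x xc)) //.
by rewrite ler_pdivrMr ?ltr0n // mulrC -ler_pdivrMr.
Qed.
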